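(* Let $\mathcal{A}$ be a unital $C^*$-algebra, $\mathcal{H}$ a Hilbert $\mathcal{A}$-module, $K\in End_{\mathcal{A}}^{*}(\mathcal{H})$, and $\mathbb{J}\subseteq\mathbb{N}$ a finite or countable index set. Let $\{T_i\}_{i\in\mathbb{J}}$ be a $K$-operator frame for $End_{\mathcal{A}}^{*}(\mathcal{H})$ with bounds $A$ and $B$. Let $\{R_i\}_{i\in\mathbb{J}}\subset End_{\mathcal{A}}^{*}(\mathcal{H})$ and $\alpha,\beta\ge0$. If $0\le\alpha+\frac{\beta}{A}<1$ and $$\Big\|\sum_{i\in\mathbb{J}}\langle(T_i-R_i)x,(T_i-R_i)x\rangle\Big\|\le\alpha\Big\|\sum_{i\in\mathbb{J}}\langle T_ix,T_ix\rangle\Big\|+\beta\big\|\langle K^*x,K^*x\rangle\big\|\qquad\text{for all }x\in\mathcal{H},$$ then $\{R_i\}_{i\in\mathbb{J}}$ is a $K$-operator frame with frame bounds $A\big(1-\sqrt{\alpha+\tfrac{\beta}{A}}\big)^2$ and $B\big(1+\sqrt{\alpha+\tfrac{\beta}{A}}\big)^2$.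
   Context: Hilbert $\mathcal{A}$-modules are left modules with $\mathcal{A}$-valued inner product $\langle\cdot,\cdot\rangle$, $\mathcal{A}$-linear in the first variable, with $\langle x,y\rangle=\langle y,x\rangle^*$, complete for $\|x\|=\|\langle x,x\rangle\|^{1/2}$. $End_{\mathcal{A}}^{*}(\mathcal{H})$ is the set of adjointable operators on $\mathcal{H}$. Inequalities between elements of $\mathcal{A}$ refer to the usual order given by the positive cone of $\mathcal{A}$. For $K\in End_{\mathcal{A}}^{*}(\mathcal{H})$, a family $\{T_i\}_{i\in\mathbb{J}}\subset End_{\mathcal{A}}^{*}(\mathcal{H})$ is a $K$-operator frame for $End_{\mathcal{A}}^{*}(\mathcal{H})$ with (lower and upper) bounds $A,B>0$ if $A\langle K^*x,K^*x\rangle\le\sum_{i\in\mathbb{J}}\langle T_ix,T_ix\rangle\le B\langle x,x\rangle$ for all $x\in\mathcal{H}$. Convention: all series of the form $\sum_{i\in\mathbb{J}}\langle T_ix,T_ix\rangle$ are taken to converge in norm in $\mathcal{A}$ (i.e. $\{T_ix\}_i\in\ell^2(\mathcal{H})$, the Hilbert $\mathcal{A}$-module of sequences $\{x_i\}$ in $\mathcal{H}$ with $\sum_i\langle x_i,x_i\rangle$ norm convergent); this convergence is part of the notion of $K$-operator frame, and an inequality involving such series includes the assertion that the series appearing in it converge in norm. *)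

(* Defs.v *)
From HB Require Import structures.
From mathcomp Require Import all_boot all_order all_algebra.
From mathcomp Require Import complex.
From mathcomp Require Import all_classical all_reals all_analysis.

Set Implicit Arguments.
Unset Strict Implicit.
Unset Printing Implicit Defensive.

Import Order.TTheory GRing.Theory Num.Theory.
Import numFieldNormedType.Exports.

Local Open Scope classical_set_scope.
Local Open Scope ring_scope.
Local Open Scope complex_scope.

Section NormConvergence.
Context {R : realType} {V : zmodType}.
Variable nrm : V -> R.

Definition norm_cvg (u : nat -> V) (a : V) : Prop :=
  nrm (u n - a) @[n --> \oo] --> (0 : R).

Definition norm_cauchy (u : nat -> V) : Prop :=
  forall e : R, 0 < e -> exists N, forall m n,
    (N <= m)%N -> (N <= n)%N -> nrm (u m - u n) < e.

Definition norm_complete : Prop :=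
  forall u, norm_cauchy u -> exists a, norm_cvg u a.

End NormConvergence.

(* Hierarchy Builder cannot join [algType] with the normed hierarchy: the join
   of [GRing.PzSemiRing] and [Num.SemiNormedZmodule] is already
   [Num.NumDomain]. The norm is therefore carried by the mixin. *)
HB.mixin Record Algebra_isCStarAlgebra (R : realType) A
    of GRing.Algebra R[i] A := {
  cnorm : A -> R ;
  star : A -> A ;
  cnormD : forall a b, cnorm (a + b) <= cnorm a + cnorm b ;
  cnormZ : forall (l : R[i]) a, cnorm (l *: a) = Normc.normc l * cnorm a ;
  cnorm_eq0 : forall a, cnorm a = 0 -> a = 0 ;
  cnormM : forall a b, cnorm (a * b) <= cnorm a * cnorm b ;
  cnorm_complete : norm_complete cnorm ;
  starK : forall a, star (star a) = a ;
  starD : forall a b, star (a + b) = star a + star b ;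
  starZ : forall (l : R[i]) a, star (l *: a) = conjc l *: star a ;
  starM : forall a b, star (a * b) = star b * star a ;
  cnorm_star : forall a, cnorm (star a * a) = cnorm a ^+ 2
}.

#[short(type="cstarAlgType")]
HB.structure Definition CStarAlgebra (R : realType) :=
  {A of GRing.Algebra R[i] A & Algebra_isCStarAlgebra R A}.

Section CStarOrder.
Context {R : realType} {A : cstarAlgType R}.
Implicit Types a b : A.

Definition invertible a : Prop := exists b, a * b = 1 /\ b * a = 1.

Definition spectrum a : set R[i] := [set l | ~ invertible (a - l%:A)].

(* In [R[i]], [0 <= l] means that l is real and nonnegative. *)
Definition cstar_pos a : Prop :=
  star a = a /\ (forall l, spectrum a l -> 0 <= l).

Definition cstar_le a b : Prop := cstar_pos (b - a).

End CStarOrder.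

Notation "a <=* b" := (cstar_le a b) (at level 70, no associativity).

(* Since A is unital, the complex vector space structure of a Hilbert A-module
   need not be given separately: l x = (l%:A) *: x. *)
HB.mixin Record Lmodule_isHilbertModule (R : realType) (A : cstarAlgType R) H
    of GRing.Lmodule A H := {
  inner : H -> H -> A ;
  inner_linear : forall (a : A) (x y z : H),
    inner (a *: x + y) z = a * inner x z + inner y z ;
  inner_star : forall x y, inner x y = star (inner y x) ;
  inner_ge0 : forall x, cstar_pos (inner x x) ;
  inner_eq0 : forall x, inner x x = 0 -> x = 0 ;
  inner_complete : norm_complete (fun x => Num.sqrt (cnorm (inner x x)))
}.

#[short(type="hilbertModType")]
HB.structure Definition HilbertModule (R : realType) (A : cstarAlgType R) :=
  {H of GRing.Lmodule A H & Lmodule_isHilbertModule R A H}.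

Section Frames.
Context {R : realType} {A : cstarAlgType R} {H : hilbertModType A}.

(* The adjoint is uniquely determined by the operator. *)
Record adjointable := Adjointable {
  op :> H -> H ;
  adj : H -> H ;
  op_adj : forall x y, inner (op x) y = inner x (adj y)
}.

Definition sq_partial_sum (J : set nat) (f : nat -> H) : nat -> A :=
  fun n => \sum_(0 <= i < n | i \in J) inner (f i) (f i).

Definition sq_summable (J : set nat) (f : nat -> H) : Prop :=
  exists s, norm_cvg cnorm (sq_partial_sum J f) s.

(* Only meaningful under [sq_summable J f]. *)
Definition sq_sum (J : set nat) (f : nat -> H) : A :=
  xget 0 [set s | norm_cvg cnorm (sq_partial_sum J f) s].

(* A family indexed by J is given by a sequence whose values outside J are
   never used. *)
Definition K_operator_frame (J : set nat) (K : adjointable)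
    (T : nat -> adjointable) (lo up : R) : Prop :=
  [/\ 0 < lo, 0 < up &
    forall x : H,
      [/\ sq_summable J (fun i => T i x),
          lo%:C *: inner (adj K x) (adj K x) <=* sq_sum J (fun i => T i x) &
          sq_sum J (fun i => T i x) <=* up%:C *: inner x x]].

End Frames.

Arguments adjointable {R A} H.

(* Main.v *)
(* The triangle inequality in l^2(H) turns the hypothesis into the norm
   inequalities (1 - q) |T x| <= |S x| <= (1 + q) |T x|, q^2 = alpha + beta / A,
   for |T x|^2 = norm of sum <T_i x, T_i x>. Both frame inequalities follow from
   their norm versions: if norm <F x, F x> <= norm <G x, G x> for all x, with F
   and G commuting with the action of the algebra, then replacing x by
   (<G x, G x> + t)^(-1/2) x gives <F x, F x> <= <G x, G x> + t, and t -> 0.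
   The C*-algebra facts needed about the spectral order come from the square
   root of 1 - x for norm x < 1 (a fixed point), from
   norm (x^2) <= norm (x^2 + y^2) for commuting self-adjoint x, y, and from
   completeness of the reals, without the spectral radius formula. *)
Require Import Defs.
From HB Require Import structures.
From mathcomp Require Import all_boot all_order all_algebra.
From mathcomp Require Import complex.
From mathcomp Require Import all_classical all_reals all_analysis.
From mathcomp Require Import ring lra.

Set Implicit Arguments.
Unset Strict Implicit.
Unset Printing Implicit Defensive.

Import Order.TTheory GRing.Theory Num.Theory.
Import numFieldNormedType.Exports.

Local Open Scope classical_set_scope.
Local Open Scope ring_scope.

(** * Norm and limits in a C*-algebra *)

Section CStarNorm.
Context {R : realType} {A : cstarAlgType R}.
Implicit Types (a b x y z : A) (r s t : R).

(** Real scalars live in the algebra as central self-adjoint elements, so that ring lemmas handle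
    them. *)
Definition rscalar r : A := (r%:C)%C%:A.

Lemma rscalar0 : rscalar 0 = 0.
Proof. by rewrite /rscalar scale0r. Qed.

Lemma rscalar1 : rscalar 1 = 1.
Proof. by rewrite /rscalar scale1r. Qed.

Lemma rscalarD r s : rscalar (r + s) = rscalar r + rscalar s.
Proof. by rewrite /rscalar rmorphD scalerDl. Qed.

Lemma rscalarN r : rscalar (- r) = - rscalar r.
Proof. by rewrite /rscalar rmorphN scaleNr. Qed.

Lemma rscalarB r s : rscalar (r - s) = rscalar r - rscalar s.
Proof. by rewrite rscalarD rscalarN. Qed.

Lemma rscalarM r s : rscalar (r * s) = rscalar r * rscalar s.
Proof. by rewrite /rscalar rmorphM mulr_algl scalerA. Qed.

Lemma rscalarC r a : rscalar r * a = a * rscalar r.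
Proof. by rewrite /rscalar mulr_algl mulr_algr. Qed.

Lemma rscalarV r : r != 0 -> rscalar r * rscalar r^-1 = 1.
Proof. by move=> r0; rewrite -rscalarM divff// rscalar1. Qed.

Lemma star0 : star (0 : A) = 0.
Proof.
by apply: (addrI (star 0)); rewrite -starD !addr0.
Qed.

Lemma starN a : star (- a) = - star a.
Proof. by apply: (addrI (star a)); rewrite -starD !subrr star0. Qed.

Lemma starB a b : star (a - b) = star a - star b.
Proof. by rewrite starD starN. Qed.

Lemma star1 : star (1 : A) = 1.
Proof.
by have := @starM _ A (star 1) 1; rewrite starK mulr1 starK => <-.
Qed.

Lemma star_rscalar r : star (rscalar r) = rscalar r.
Proof. by rewrite /rscalar starZ star1 conjc_real. Qed.

Lemma star_rscalarM r a : star (rscalar r * a) = rscalar r * star a.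
Proof. by rewrite starM star_rscalar rscalarC. Qed.

Lemma cnorm_realZ r a : cnorm (r%:C%C *: a) = `|r| * cnorm a.
Proof. by rewrite cnormZ /= expr0n addr0 sqrtr_sqr. Qed.

Lemma cnorm_rscalarM r a : cnorm (rscalar r * a) = `|r| * cnorm a.
Proof. by rewrite mulr_algl cnorm_realZ. Qed.

Lemma cnorm0 : cnorm (0 : A) = 0.
Proof. by rewrite -(mul0r 0) -rscalar0 cnorm_rscalarM normr0 mul0r. Qed.

Lemma cnormN a : cnorm (- a) = cnorm a.
Proof.
by rewrite -[in LHS](mul1r a) -mulNr -rscalar1 -rscalarN cnorm_rscalarM
  normrN1 mul1r.
Qed.

Lemma cnorm_ge0 a : 0 <= cnorm a.
Proof.
have := cnormD a (- a); rewrite subrr cnorm0 cnormN; lra.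
Qed.

Lemma cnormB a b : cnorm (a - b) <= cnorm a + cnorm b.
Proof. by rewrite -(cnormN b) cnormD. Qed.

Lemma cnormBC a b : cnorm (a - b) = cnorm (b - a).
Proof. by rewrite -cnormN opprB. Qed.

Lemma cnorm_dist a b c : cnorm (a - c) <= cnorm (a - b) + cnorm (b - c).
Proof. by rewrite (le_trans _ (cnormD _ _))// addrA subrK. Qed.

Lemma cnorm1_le : cnorm (1 : A) <= 1.
Proof.
have := cnorm_star (1 : A); rewrite star1 mulr1; have := @cnorm_ge0 1; nra.
Qed.

Lemma cnorm_rscalar r : cnorm (rscalar r) <= `|r|.
Proof.
by rewrite -(mulr1 (rscalar r)) cnorm_rscalarM ler_piMr// cnorm1_le.
Qed.

(** Submultiplicativity turns the C*-identity into [cnorm b <= cnorm (star b)]; this is applied to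
    [a] and to [star a]. *)
Lemma cnorm_starE a : cnorm (star a) = cnorm a.
Proof.
have le b : cnorm b <= cnorm (star b).
  have := cnormM (star b) b; rewrite cnorm_star.
  have := cnorm_ge0 b; have := cnorm_ge0 (star b); nra.
by apply/eqP; rewrite eq_le le -[X in _ <= cnorm X]starK le.
Qed.

Lemma cnorm_sqr a : star a = a -> cnorm (a * a) = cnorm a ^+ 2.
Proof. by move=> sa; rewrite -cnorm_star sa. Qed.

(* With [z = x + i y], commutation gives [star z * z = x * x + y * y], while
   [2 x = z + star z]. *)
Lemma cnorm_sum_sqr x y : star x = x -> star y = y -> GRing.comm x y ->
  cnorm x ^+ 2 <= cnorm (x * x + y * y).
Proof.
move=> sx sy xy.
pose z : A := x + ('i)%C *: y.
have sz : star z = x - ('i)%C *: y.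
  rewrite /z starD starZ sx sy -scaleNr; congr (_ + _ *: _).
  by apply/eqP; rewrite eq_complex/= oppr0 !eqxx.
have zz : star z * z = x * x + y * y.
  rewrite sz /z mulrBl !mulrDr -!scalerAl -!scalerAr scalerA.
  rewrite (_ : 'i * 'i = -1)%C; last exact: sqr_i.
  by rewrite scaleN1r opprD opprK xy addrA addrK.
rewrite -zz cnorm_star ler_pXn2r ?nnegrE ?cnorm_ge0//.
have x2 : rscalar 2 * x = z + star z.
  by rewrite sz /z addrACA subrr addr0 rscalarD rscalar1 mulrDl mul1r.
have := cnormD z (star z).
rewrite -x2 cnorm_rscalarM cnorm_starE normr_nat; lra.
Qed.

(** * Norm convergence *)

Lemma norm_cvgP (u : nat -> A) a : norm_cvg cnorm u a <->
  forall e, 0 < e -> exists N, forall n, (N <= n)%N -> cnorm (u n - a) < e.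
Proof.
split=> [/cvgrPdist_lt h e e0|h].
  have [N _ hN] := h _ e0; exists N => n /hN /=.
  by rewrite sub0r normrN ger0_norm// cnorm_ge0.
apply/cvgrPdist_lt => e /h[N hN]; exists N => // n /hN /=.
by rewrite sub0r normrN ger0_norm// cnorm_ge0.
Qed.

Lemma norm_cvg_cst a : norm_cvg cnorm (fun=> a) a.
Proof. by apply/norm_cvgP => e e0; exists 0 => n _; rewrite subrr cnorm0. Qed.

Lemma norm_cvg_lip (f : A -> A) (u : nat -> A) a r :
    (forall n, cnorm (f (u n) - f a) <= r * cnorm (u n - a)) ->
  norm_cvg cnorm u a -> norm_cvg cnorm (f \o u) (f a).
Proof.
move=> fr /norm_cvgP ua; apply/norm_cvgP => e e0.
have [N uN] := ua (e / (`|r| + 1)) (divr_gt0 e0 (ltr_wpDl (normr_ge0 _) ltr01)).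
exists N => n /uN; rewrite ltr_pdivlMr ?ltr_wpDl// => un.
apply: (le_lt_trans (fr n)); apply: le_lt_trans un.
by rewrite mulrC ler_wpM2l ?cnorm_ge0// (le_trans (ler_norm r))// lerDl.
Qed.

Lemma norm_cvgD (u v : nat -> A) a b : norm_cvg cnorm u a ->
  norm_cvg cnorm v b -> norm_cvg cnorm (fun n => u n + v n) (a + b).
Proof.
move=> /norm_cvgP ua /norm_cvgP vb; apply/norm_cvgP => e e0.
have [N uN] := ua _ (divr_gt0 e0 (ltr0n _ 2)).
have [M vM] := vb _ (divr_gt0 e0 (ltr0n _ 2)).
exists (maxn N M) => n; rewrite geq_max => /andP[/uN un /vM vn].
rewrite opprD addrACA; apply: le_lt_trans (cnormD _ _) _; lra.
Qed.

Lemma norm_cvg_mul x y (u : nat -> A) a :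
  norm_cvg cnorm u a -> norm_cvg cnorm (fun n => x * u n * y) (x * a * y).
Proof.
apply: (@norm_cvg_lip (fun v => x * v * y) _ _ (cnorm x * cnorm y)) => n.
rewrite -mulrBl -mulrBr (le_trans (cnormM _ _))//.
rewrite (le_trans (ler_wpM2r (cnorm_ge0 _) (cnormM _ _)))//.
by rewrite mulrAC.
Qed.

Lemma norm_cvgMl x (u : nat -> A) a :
  norm_cvg cnorm u a -> norm_cvg cnorm (fun n => x * u n) (x * a).
Proof.
move=> /(@norm_cvg_mul x 1); rewrite mulr1.
by under [X in norm_cvg _ X _]eq_fun do rewrite mulr1.
Qed.

Lemma norm_cvgMr x (u : nat -> A) a :
  norm_cvg cnorm u a -> norm_cvg cnorm (fun n => u n * x) (a * x).
Proof.
move=> /(@norm_cvg_mul 1 x); rewrite mul1r.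
by under [X in norm_cvg _ X _]eq_fun do rewrite mul1r.
Qed.

Lemma norm_cvg_star (u : nat -> A) a :
  norm_cvg cnorm u a -> norm_cvg cnorm (fun n => star (u n)) (star a).
Proof.
apply: (@norm_cvg_lip star _ _ 1) => n.
by rewrite -starB cnorm_starE mul1r.
Qed.

Lemma norm_limit_unique (u : nat -> A) a b :
  norm_cvg cnorm u a -> norm_cvg cnorm u b -> a = b.
Proof.
move=> /norm_cvgP ua /norm_cvgP ub; apply/eqP; rewrite -subr_eq0; apply/eqP.
apply: cnorm_eq0; apply/eqP; rewrite eq_le cnorm_ge0 andbT.
apply/ler_addgt0Pr => e e0; rewrite add0r.
have [N uN] := ua _ (divr_gt0 e0 (ltr0n _ 2)).
have [M uM] := ub _ (divr_gt0 e0 (ltr0n _ 2)).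
apply: (le_trans (cnorm_dist _ (u (maxn N M)) _)).
have := uN _ (leq_maxl N M); have := uM _ (leq_maxr N M).
rewrite (cnormBC a); lra.
Qed.

Lemma norm_cvg_le (u : nat -> A) a r :
  (forall n, cnorm (u n) <= r) -> norm_cvg cnorm u a -> cnorm a <= r.
Proof.
move=> ur /norm_cvgP ua; apply/ler_addgt0Pr => e /ua[N uN].
have := ur N; have := uN N (leqnn _); have := cnormD (u N) (a - u N).
rewrite subrKC cnormBC; lra.
Qed.

Lemma contractive_cvg (u : nat -> A) q : 0 <= q -> q < 1 ->
    (forall n, cnorm (u n.+2 - u n.+1) <= q * cnorm (u n.+1 - u n)) ->
  exists a, norm_cvg cnorm u a.
Proof.
move=> q0 q1 uq; apply: cnorm_complete.
set M := cnorm (u 1%N - u 0%N).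
have step n : cnorm (u n.+1 - u n) <= M * q ^+ n.
  elim: n => [|n ih]; first by rewrite expr0 mulr1.
  by rewrite (le_trans (uq n))// exprS mulrCA ler_wpM2l.
(* The factor [1 - q ^+ k], sharper than what is used afterwards, is what makes the induction on [k]
   close. *)
have tail n k : cnorm (u (n + k)%N - u n) * (1 - q) <=
    M * q ^+ n * (1 - q ^+ k).
  elim: k => [|k ih].
    by rewrite addn0 !subrr cnorm0 mul0r mulr0.
  have := cnorm_dist (u (n + k.+1)%N) (u (n + k)%N) (u n).
  have := step (n + k)%N; rewrite addnS exprD exprS mulrA => h1 h2.
  have : 0 < 1 - q by lra.
  move: h1 h2 ih; set c1 := cnorm _; set c2 := cnorm _; set c3 := cnorm _.
  set p := M * q ^+ n; move: (q ^+ k) => w; nra.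
have tl n k : (n <= k)%N -> cnorm (u k - u n) * (1 - q) <= M * q ^+ n.
  move=> nk; have := tail n (k - n)%N; rewrite subnKC// => h.
  apply: (le_trans h); rewrite ler_piMr ?mulr_ge0 ?cnorm_ge0 ?exprn_ge0//.
  by rewrite gerBl exprn_ge0.
move=> e e0.
(* The two tails from [N] contribute [2 * M * q ^+ N]; [M + 1] keeps the denominator positive when
   [M = 0]. *)
have /cvgrPdist_lt/(_ (e * (1 - q) / (2 * (M + 1)))) :
    (q ^+ n @[n --> \oo] --> (0 : R)).
  by apply: cvg_expr; rewrite ger0_norm.
have M0 : 0 <= M by exact: cnorm_ge0.
case=> [|N _ hN]; first by rewrite divr_gt0 ?mulr_gt0 ?subr_gt0//; lra.
exists N => m n Nm Nn.
have := hN N (leqnn _); rewrite /= sub0r normrN ger0_norm ?exprn_ge0//.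
rewrite ltr_pdivlMr ?mulr_gt0//; last lra.
have := tl _ _ Nm; have := tl _ _ Nn; have := cnorm_dist (u m) (u N) (u n).
rewrite (cnormBC (u N) (u n)).
have := exprn_ge0 N q0; move: (q ^+ N) => w w0.
move: (cnorm (u m - u N)) (cnorm (u n - u N)) (cnorm (u m - u n)) => c1 c2 c3.
have : 0 < 1 - q by lra.
nra.
Qed.

End CStarNorm.

(** * Square roots *)

Section CStarSqrt.
Context {R : realType} {A : cstarAlgType R}.
Implicit Types (a b x y z : A) (r s t : R).

Lemma comm_rscalar a r : GRing.comm a (rscalar r).
Proof. by rewrite /GRing.comm -rscalarC. Qed.

Lemma rscalarMACA r s a b :
  rscalar r * a * (rscalar s * b) = rscalar (r * s) * (a * b).
Proof. by rewrite rscalarM -!mulrA; congr (_ * _); rewrite !mulrA rscalarC. Qed.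

Lemma invertibleM a b : invertible a -> invertible b -> invertible (a * b).
Proof.
move=> [a' [aa' a'a]] [b' [bb' b'b]]; exists (b' * a'); split.
  by rewrite mulrA -(mulrA a) bb' mulr1.
by rewrite mulrA -(mulrA b') a'a mulr1.
Qed.

Lemma invertible_rscalar r : r != 0 -> invertible (rscalar r : A).
Proof.
move=> r0; exists (rscalar r^-1); split; first exact: rscalarV.
by rewrite rscalarC rscalarV.
Qed.

Lemma comm_inv a b z : a * b = 1 -> b * a = 1 -> GRing.comm z a ->
  GRing.comm z b.
Proof.
move=> ab ba za; rewrite /GRing.comm.
by rewrite -[LHS]mul1r -ba -mulrA (mulrA a) -za -mulrA ab mulr1.
Qed.

Lemma star_inv a b : star a = a -> a * b = 1 -> b * a = 1 -> star b = b.
Proof.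
move=> sa ab ba.
have ba' : star b * a = 1 by rewrite -[in LHS]sa -starM ab star1.
by rewrite -[LHS]mulr1 -ab mulrA ba' mul1r.
Qed.

(** The inverse [c] of [a * b] commutes with [a], because [a] commutes with [a * b]; then [b * c] is
    a two-sided inverse of [a]. *)
Lemma comm_invertibleM a b : GRing.comm a b -> invertible (a * b) ->
  invertible a.
Proof.
move=> ab [c [abc cab]]; exists (b * c); split; first by rewrite mulrA.
have ca : GRing.comm a c.
  by apply: comm_inv abc cab _; rewrite /GRing.comm -mulrA ab.
by rewrite -mulrA -ca mulrA -ab.
Qed.

Lemma norm_cvg_comm z (u : nat -> A) a : (forall n, GRing.comm z (u n)) ->
  norm_cvg cnorm u a -> GRing.comm z a.
Proof.
move=> zu ua; rewrite /GRing.comm; apply: norm_limit_unique (norm_cvgMl z ua) _.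
rewrite (_ : (fun n => z * u n) = (fun n => u n * z)); first exact: norm_cvgMr.
by apply/funext => n; exact: zu.
Qed.

Lemma norm_cvg_shift (u : nat -> A) a : norm_cvg cnorm u a ->
  norm_cvg cnorm (fun n => u n.+1) a.
Proof.
move=> /norm_cvgP ua; apply/norm_cvgP => e /ua[N uN].
by exists N => n Nn; apply: uN; exact: leqW.
Qed.

(** Iterating [1 + x * u] from 1 gives the partial sums of the geometric series; the limit is a
    fixed point, that is, an inverse. *)
Lemma neumann x : cnorm x < 1 -> invertible (1 - x).
Proof.
move=> x1.
pose u := fix u n : A := if n is n.+1 then 1 + x * u n else 1.
have [a ua] : exists a, norm_cvg cnorm u a.
  apply: (contractive_cvg (cnorm_ge0 x) x1) => n /=.
  by rewrite opprD addrACA subrr add0r -mulrBr cnormM.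
have xu n : GRing.comm x (u n).
  elim: n => [|n ih] /=; first exact: commr1.
  by apply: commrD; [exact: commr1|exact: commrM].
have xa := norm_cvg_comm xu ua.
have ea : a = 1 + x * a.
  apply: norm_limit_unique (norm_cvg_shift ua) _ => /=.
  exact: norm_cvgD (norm_cvg_cst 1) (norm_cvgMl x ua).
have e1 : (1 - x) * a = 1 by rewrite mulrBl mul1r {1}ea addrK.
by exists a; split=> //; rewrite mulrBr mulr1 -xa -[X in X - _]mul1r -mulrBl.
Qed.

(* [1 - a], where [a] solves [2 a = x + a * a]. *)
Lemma sqrt_one_sub x : star x = x -> cnorm x < 1 ->
  exists y, [/\ star y = y, y * y = 1 - x &
    forall z, GRing.comm z x -> GRing.comm z y].
Proof.
move=> sx x1.
pose h : A := rscalar 2^-1.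
have ch a b : cnorm (h * a - h * b) = cnorm (a - b) / 2.
  by rewrite -mulrBr cnorm_rscalarM ger0_norm ?invr_ge0// mulrC.
(* Started at 0, the iterates stay in the ball of radius [r = cnorm x < 1], since
   [(r + r ^+ 2) / 2 <= r]. *)
pose u := fix u n : A := if n is n.+1 then h * (x + u n * u n) else 0.
have ux n : cnorm (u n) <= cnorm x.
  elim: n => [|n ih] /=; first by rewrite cnorm0 cnorm_ge0.
  rewrite cnorm_rscalarM ger0_norm ?invr_ge0//.
  have := cnormD x (u n * u n); have := cnormM (u n) (u n).
  have := cnorm_ge0 (u n); have := cnorm_ge0 x; nra.
have comm_u z : GRing.comm z x -> forall n, GRing.comm z (u n).
  move=> zx; elim=> [|n ih] /=; first exact: commr0.
  by apply: commrM (comm_rscalar _ _) _; apply: commrD => //; exact: commrM.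
(* Each iterate commutes with all that commutes with [x], hence with the other iterates; this allows
   [a * a - b * b] to be factored below. *)
have uC m n : GRing.comm (u m) (u n).
  by apply: (comm_u); apply/commr_sym/comm_u.
have sqB a b : GRing.comm a b -> a * a - b * b = (a - b) * (a + b).
  by move=> ab; rewrite mulrBl !mulrDr ab opprD addrA addrK.
(* The factor [a + b] has norm at most [2 * cnorm x], and [h] halves it, so the map contracts by
   [cnorm x]. *)
have lip a b : GRing.comm a b -> cnorm a <= cnorm x -> cnorm b <= cnorm x ->
    cnorm (h * (x + a * a) - h * (x + b * b)) <= cnorm x * cnorm (a - b).
  move=> ab ax bx; rewrite ch opprD addrACA subrr add0r sqB//.
  have := cnormM (a - b) (a + b); have := cnormD a b.
  have := cnorm_ge0 (a - b); have := cnorm_ge0 (a + b); nra.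
have [a ua] : exists a, norm_cvg cnorm u a.
  by apply: (contractive_cvg (cnorm_ge0 x) x1) => n;
    exact: lip (uC n.+1 n) (ux _) (ux _).
have ax : cnorm a <= cnorm x := norm_cvg_le ux ua.
have comm_a z : GRing.comm z x -> GRing.comm z a.
  by move=> zx; exact: norm_cvg_comm (comm_u _ zx) ua.
have su n : star (u n) = u n.
  elim: n => [|n ih] /=; first exact: star0.
  by rewrite star_rscalarM starD starM ih sx.
have sa : star a = a.
  apply: norm_limit_unique (norm_cvg_star ua) _.
  by rewrite (_ : (fun n => star (u n)) = u)//; exact/funext.
have ea : a = h * (x + a * a).
  apply: norm_limit_unique (norm_cvg_shift ua) _ => /=.
  apply: (norm_cvg_lip (f := fun a => h * (x + a * a)) (r := cnorm x)) ua => n.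
  apply: (lip) => //; exact/comm_a/commr_sym/comm_u.
have aa : a + a = x + a * a.
  have -> : a + a = rscalar 2 * a by rewrite rscalarD rscalar1 mulrDl mul1r.
  by rewrite {1}ea mulrA -rscalarM mulfV// rscalar1 mul1r.
exists (1 - a); split; first by rewrite starB star1 sa.
  have -> : x = a + a - a * a by rewrite aa addrK.
  by rewrite mulrBl mul1r mulrBr mulr1 !opprB opprD -addrA (addrCA (- a)).
by move=> z /comm_a za; apply: commrB => //; exact: commr1.
Qed.

(* The elements [a >= eps > 0], written without reference to the spectrum. *)
Definition strictly_pos a : Prop :=
  star a = a /\ exists c, cnorm (rscalar c - a) < c.

(** In the norm form, additivity is just the triangle inequality, with the constants added. *)
Lemma strictly_posD a b : strictly_pos a -> strictly_pos b ->
  strictly_pos (a + b).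
Proof.
move=> [sa [c ac]] [sb [d bd]]; split; first by rewrite starD sa sb.
exists (c + d); rewrite rscalarD opprD addrACA.
by apply: le_lt_trans (cnormD _ _) _; exact: ltrD.
Qed.

Lemma strictly_pos_shift a r s : star a = a -> cnorm (rscalar r - a) <= r ->
  0 < s -> strictly_pos (a + rscalar s).
Proof.
move=> sa ar s0; split; first by rewrite starD sa star_rscalar.
by exists (r + s); rewrite rscalarD opprD addrACA subrr addr0; lra.
Qed.

Lemma strictly_pos_rscalar s : 0 < s -> strictly_pos (rscalar s : A).
Proof.
move=> s0; rewrite -[rscalar s]add0r; apply: (@strictly_pos_shift _ 0) => //.
  exact: star0.
by rewrite rscalar0 subrr cnorm0.
Qed.

(** Normal form [c * (1 - x)] with [cnorm x < 1], to which [neumann] and [sqrt_one_sub] apply. *)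
Lemma strictly_pos_scale a : strictly_pos a -> exists c, [/\ 0 < c,
  a = rscalar c * (1 - (1 - rscalar c^-1 * a)),
  cnorm (1 - rscalar c^-1 * a) < 1 & star a = a].
Proof.
move=> [sa [c ac]]; have c0 : 0 < c := le_lt_trans (cnorm_ge0 _) ac.
exists c; split=> //.
  by rewrite subKr mulrA rscalarV ?gt_eqF// mul1r.
have -> : 1 - rscalar c^-1 * a = rscalar c^-1 * (rscalar c - a).
  by rewrite mulrBr -rscalarM mulVf ?gt_eqF// rscalar1.
by rewrite cnorm_rscalarM ger0_norm ?invr_ge0 ?ltW// ltr_pdivrMl// mulr1.
Qed.

Lemma strictly_pos_invertible a : strictly_pos a -> invertible a.
Proof.
move=> /strictly_pos_scale[c [c0 ea ac _]].
rewrite ea; apply: invertibleM; last exact: neumann.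
by apply: invertible_rscalar; rewrite gt_eqF.
Qed.

Lemma strictly_pos_sqrt a : strictly_pos a -> exists b, [/\ star b = b,
  b * b = a & forall z, GRing.comm z a -> GRing.comm z b].
Proof.
move=> /strictly_pos_scale[c [c0 ea ac sa]].
have [|y [sy yy yC]] := sqrt_one_sub _ ac.
  by rewrite starB star1 star_rscalarM sa.
exists (rscalar (Num.sqrt c) * y); split; first by rewrite star_rscalarM sy.
  by rewrite rscalarMACA -expr2 sqr_sqrtr ?ltW// yy -ea.
move=> z za; apply: commrM (comm_rscalar _ _) _; apply: yC.
by apply: commrB (commr1 _) _; exact: commrM (comm_rscalar _ _) _.
Qed.

(** Scale [x] to [k] with [cnorm (k * k) < 1] and let [y] be a root of [1 - k * k]. As [y] and [k]
    commute, [cnorm_sum_sqr] gives [cnorm (1 - k * k) <= cnorm 1 <= 1]; scaled back, this is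
    [cnorm (r - x * x) <= r]. *)
Lemma strictly_pos_sqr x s : star x = x -> 0 < s ->
  strictly_pos (x * x + rscalar s).
Proof.
move=> sx s0; pose r := cnorm (x * x) + 1.
have r0 : 0 < r by rewrite ltr_wpDl ?cnorm_ge0.
pose k : A := rscalar (Num.sqrt r)^-1 * x.
have kk : k * k = rscalar r^-1 * (x * x).
  by rewrite rscalarMACA -expr2 exprVn sqr_sqrtr ?ltW.
have sk : star k = k by rewrite star_rscalarM sx.
have [||y [sy yy yC]] := @sqrt_one_sub (k * k).
- by rewrite starM sk.
- rewrite kk cnorm_rscalarM ger0_norm ?invr_ge0 ?ltW//.
  by rewrite ltr_pdivrMl// mulr1 /r ltrDl.
have kC : GRing.comm k (k * k) by exact: commrM.
have := cnorm_sum_sqr sy sk (commr_sym (yC _ kC)).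
rewrite yy subrK -cnorm_sqr// yy kk => h.
apply: (@strictly_pos_shift _ r) => //; first by rewrite starM sx.
have -> : rscalar r - x * x = rscalar r * (1 - rscalar r^-1 * (x * x)).
  by rewrite mulrBr mulr1 (mulrA (rscalar r)) rscalarV ?gt_eqF// mul1r.
rewrite cnorm_rscalarM gtr0_norm// ler_piMr ?(ltW r0)//.
by apply: (le_trans h); exact: cnorm1_le.
Qed.

End CStarSqrt.

(** * Positivity *)

Section CStarPositivity.
Context {R : realType} {A : cstarAlgType R}.
Implicit Types (a b x y z : A) (r s t : R).

(** [x * x - t] factors as [x * x * (1 - t * z)]; the root is [x * c] with [c] a root of [1 - t * z]
    commuting with [x]. *)
Lemma sqrt_sub_rscalar x z t : star x = x -> x * x * z = 1 -> z * (x * x) = 1 ->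
  cnorm (rscalar t * z) < 1 ->
  exists y, star y = y /\ y * y = x * x - rscalar t.
Proof.
move=> sx xz zx tz.
have xC : GRing.comm x z by apply: comm_inv xz zx _; exact: commrM.
have sz : star z = z by apply: star_inv xz zx; rewrite starM sx.
have [|c [sc cc cC]] := sqrt_one_sub _ tz; first by rewrite star_rscalarM sz.
have xc : GRing.comm x c by apply: cC; apply: commrM => //; exact: comm_rscalar.
exists (x * c); split; first by rewrite starM sx sc -xc.
rewrite -mulrA (mulrA c) -xc -mulrA cc mulrA mulrBr mulr1.
by rewrite mulrA -(rscalarC t) -mulrA xz mulr1.
Qed.

(** For small [t] the element [x * x - t] is still a square [y * y], and [y * y + t] is strictly
    positive. *)
Lemma strictly_pos_sqr_invertible x : star x = x -> invertible (x * x) ->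
  strictly_pos (x * x).
Proof.
move=> sx [z [xz zx]]; pose t := (cnorm z + 1)^-1.
have z1 : 0 < cnorm z + 1 by rewrite ltr_wpDl// cnorm_ge0.
have t0 : 0 < t by rewrite invr_gt0.
have [|y [sy yy]] := @sqrt_sub_rscalar x z t sx xz zx.
  by rewrite cnorm_rscalarM gtr0_norm// ltr_pdivrMl// mulr1 ltrDl.
by have := strictly_pos_sqr sy t0; rewrite yy subrK.
Qed.

(* The set of [t > 0] with [a + t] strictly positive is closed upwards; it is
   open to the left because a strictly positive [a + t] is a square, and so is
   [a + t - d] for small [d]. The bound on [d] depends only on the inverse of
   [a + t], hence the infimum is [0]. *)
Lemma strictly_pos_invertible_shift a : star a = a ->
  (forall s, 0 < s -> invertible (a + rscalar s)) ->
  forall s, 0 < s -> strictly_pos (a + rscalar s).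
Proof.
move=> sa inva.
pose E := [set t | 0 < t /\ strictly_pos (a + rscalar t)].
have upE t s : E t -> t < s -> E s.
  move=> [t0 at0] ts; split; first exact: lt_trans ts.
  rewrite -(subrKC t s) rscalarD addrA.
  by apply: strictly_posD => //; apply: strictly_pos_rscalar; rewrite subr_gt0.
have infE : has_inf E.
  split; last by exists 0 => t [/ltW].
  exists (cnorm a + 1).
  have a1 : 0 < cnorm a + 1 by rewrite ltr_wpDl ?cnorm_ge0.
  split=> //; split; first by rewrite starD sa star_rscalar.
  by exists (cnorm a + 1); rewrite opprD addrCA subrr addr0 cnormN ltrDl.
have gtE s : inf E < s -> E s.
  by move=> /(inf_lt infE.1)[t Et ts]; exact: upE ts.
suff inf0 : inf E <= 0 by move=> s s0; case: (gtE s (le_lt_trans inf0 s0)).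
rewrite leNgt; apply/negP => t0; set t := inf E in t0 gtE.
have [d [ad da]] := inva _ t0.
(* [M] dominates both [cnorm d] and [t^-1], so that [e < t] and [e * cnorm d <= 1 / 4]. *)
pose M := cnorm d + t^-1 + 1.
have ti : 0 < t^-1 by rewrite invr_gt0.
have dge := cnorm_ge0 d.
have M0 : 0 < M by rewrite /M; lra.
pose e := (4 * M)^-1.
have e0 : 0 < e by rewrite invr_gt0; lra.
have eM : 4 * e * M = 1.
  by rewrite /e; field; rewrite gt_eqF.
have et : e < t.
  have tt : t * t^-1 = 1 by rewrite divff// gt_eqF.
  have : e * t^-1 < e * M by rewrite ltr_pM2l// /M; lra.
  nra.
have te : t < t + e by rewrite ltrDl.
have [te0 spe] := gtE _ te.
have [b [sb bb _]] := strictly_pos_sqrt spe.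
have [z [bz zb]] := strictly_pos_invertible spe.
(* Resolvent identity for the inverses [z] at [t + e] and [d] at [t]. It yields
   [cnorm z <= 4 / 3 * cnorm d], so [2 * e * cnorm z < 1]. *)
have ez : z = d - rscalar e * (z * d).
  have {1}-> : z = z * (a + rscalar t) * d by rewrite -mulrA ad mulr1.
  have -> : a + rscalar t = a + rscalar (t + e) - rscalar e.
    by rewrite rscalarD addrA addrK.
  by rewrite mulrBr zb mulrBl mul1r -rscalarC -mulrA.
have zle : cnorm (rscalar (2 * e) * z) < 1.
  rewrite cnorm_rscalarM gtr0_norm; last lra.
  have := cnormB d (rscalar e * (z * d)).
  rewrite -ez cnorm_rscalarM gtr0_norm//.
  have := cnormM z d; have := cnorm_ge0 z.
  have := cnorm_ge0 (z * d).
  have dM : cnorm d <= M by rewrite /M; lra.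
  have : e * cnorm d <= 1 / 4 by nra.
  move: (cnorm (z * d)) (cnorm z) (cnorm d) dM => p q w; nra.
(* Subtracting [2 * e] from [a + t + e] leaves the square [a + t - e]; adding back [e / 2] puts
   [t - e / 2], below the infimum, in [E]. *)
have [||y [sy yy]] := sqrt_sub_rscalar sb _ _ zle.
- by rewrite bb.
- by rewrite bb.
have e2 : 0 < e / 2 by lra.
have := strictly_pos_sqr sy e2.
rewrite yy bb -addrA -addrA -rscalarN -!rscalarD => h.
have : E (t - e / 2).
  split; first by lra.
  by rewrite (_ : t - e / 2 = t + e + (- (2 * e) + e / 2)) //; lra.
by move=> /(ge_inf infE.2); rewrite -/t; lra.
Qed.

(** * From the spectrum to strict positivity *)

(** For [l = p + i q] with [q] nonzero, multiply [a - l], that is [(a - p) - i q], by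
    [(a - p) + i q]: the product [(a - p) ^+ 2 + q ^+ 2] is strictly positive, hence invertible, and
    so is its commuting factor [a - l]. *)
Lemma spectrum_real a l : star a = a -> spectrum a l -> complex.Im l = 0.
Proof.
case: l => p q sa spl; apply/eqP/negPn/negP => /= q0; apply: spl.
pose k := a - rscalar p; pose w : A := (Complex 0 q)%:A.
have el : a - (Complex p q)%:A = k - w.
  rewrite /k /w /rscalar -addrA -opprD -scalerDl; congr (_ - _%:A).
  by apply/eqP; rewrite eq_complex/= addr0 add0r !eqxx.
have kw : GRing.comm k w by rewrite /GRing.comm /w mulr_algl mulr_algr.
have ww : w * w = - rscalar (q ^+ 2).
  rewrite /w /rscalar mulr_algl scalerA -scaleNr; congr (_ *: _).
  by apply/eqP; rewrite eq_complex/= !mul0r !mulr0 addr0 sub0r oppr0 !eqxx.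
have sk : star k = k by rewrite starB star_rscalar sa.
rewrite el; clearbody k w => {el}.
have e : (k - w) * (k + w) = k * k + rscalar (q ^+ 2).
  by rewrite mulrBl !mulrDr ww -kw opprD opprK addrA addrK.
apply: (@comm_invertibleM _ _ _ (k + w)).
  by rewrite /GRing.comm e mulrBr !mulrDl ww -kw opprD opprK addrA addrK.
rewrite e; apply: strictly_pos_invertible; apply: strictly_pos_sqr => //.
by rewrite exprn_even_gt0.
Qed.

Lemma cstar_pos_invertible a : star a = a ->
  (forall s, 0 < s -> invertible (a + rscalar s)) -> cstar_pos a.
Proof.
move=> sa inva; split=> // l spl.
have := spectrum_real sa spl; case: l spl => p q spl /= q0.
rewrite q0 in spl *; rewrite lecE/= eqxx/= leNgt; apply/negP => p0; apply: spl.
by have := inva (- p); rewrite oppr_gt0 rscalarN; exact.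
Qed.

(** Exchanges the spectral definition for norm estimates, in which sums and limits can be
    handled. *)
Lemma cstar_posP a : cstar_pos a <->
  star a = a /\ forall s, 0 < s -> strictly_pos (a + rscalar s).
Proof.
split=> [[sa spa]|[sa pa]]; last first.
  by apply: cstar_pos_invertible => // s /pa; exact: strictly_pos_invertible.
split=> //; apply: strictly_pos_invertible_shift => // s s0.
apply: contrapT => ninv.
have /spa : spectrum a (- s)%:C%C.
  by rewrite /spectrum/= -/(rscalar _) rscalarN opprK.
by rewrite lecE/= eqxx/= oppr_ge0 leNgt s0.
Qed.

Lemma cstar_posD a b : cstar_pos a -> cstar_pos b -> cstar_pos (a + b).
Proof.
move=> /cstar_posP[sa pa] /cstar_posP[sb pb].
apply/cstar_posP; split=> [|s s0]; first by rewrite starD sa sb.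
have s2 : 0 < s / 2 by rewrite divr_gt0.
by rewrite [s]splitr rscalarD addrACA;
  apply: strictly_posD; [exact: pa|exact: pb].
Qed.

Lemma cstar_pos_sqr x : star x = x -> cstar_pos (x * x).
Proof.
move=> sx; apply/cstar_posP; split=> [|s s0]; first by rewrite starM sx.
exact: strictly_pos_sqr.
Qed.

Lemma cstar_pos_sub_norm a r : star a = a -> cnorm a <= r ->
  cstar_pos (rscalar r - a).
Proof.
move=> sa ar; apply/cstar_posP.
have s' : star (rscalar r - a) = rscalar r - a by rewrite starB star_rscalar sa.
by split=> // s s0; apply: (@strictly_pos_shift _ _ _ r) => //; rewrite subKr.
Qed.

(** Roots [x] of [a + s] and [y] of [r - a + s] commute and [x * x + y * y = r + 2 s], so
    [cnorm_sum_sqr] bounds [cnorm (a + s)] by [r + 2 s]. *)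
Lemma cstar_pos_bound a r : 0 <= r ->
  cstar_pos a -> cstar_pos (rscalar r - a) -> cnorm a <= r.
Proof.
move=> r0 /cstar_posP[sa pa] /cstar_posP[_ pra].
have bound s : 0 < s -> cnorm (a + rscalar s) <= r + s + s.
  move=> s0; have [x [sx xx xC]] := strictly_pos_sqrt (pa _ s0).
  have [y [sy yy yC]] := strictly_pos_sqrt (pra _ s0).
  have aC : GRing.comm a (a + rscalar s).
    by apply: commrD => //; exact: comm_rscalar.
  have xy : GRing.comm x y.
    apply: yC; apply: commrD; last exact: comm_rscalar.
    by apply: commrB; [exact: comm_rscalar|exact/commr_sym/xC].
  have := cnorm_sum_sqr sx sy xy.
  rewrite -cnorm_sqr// xx yy addrACA subrKC -addrA -!rscalarD addrA => h.
  apply: (le_trans h); apply: (le_trans (cnorm_rscalar _)).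
  by rewrite ger0_norm//; lra.
apply/ler_addgt0Pr => e e0.
have e3 : 0 < e / 3 by rewrite divr_gt0.
have := bound _ e3; have := cnormB (a + rscalar (e / 3)) (rscalar (e / 3)).
rewrite addrK; have : cnorm (rscalar (e / 3) : A) <= `|e / 3|.
  exact: cnorm_rscalar.
rewrite gtr0_norm//; lra.
Qed.

(** In the order, [a] lies below [b] and [b] below [cnorm b], so [cstar_pos_bound] applies with
    [r = cnorm b]. *)
Lemma cnorm_mono a b : cstar_pos a -> a <=* b -> cnorm a <= cnorm b.
Proof.
move=> pa pab; apply: (cstar_pos_bound (cnorm_ge0 b) pa).
have sb : star b = b by rewrite -(subrK a b) starD pab.1 pa.1.
by rewrite -(subrKA b); apply: cstar_posD => //; exact: cstar_pos_sub_norm.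
Qed.

Lemma cstar_pos_cvg (u : nat -> A) a : (forall n, cstar_pos (u n)) ->
  norm_cvg cnorm u a -> cstar_pos a.
Proof.
move=> pu ua; have sa : star a = a.
  apply: norm_limit_unique (norm_cvg_star ua) _.
  rewrite (_ : (fun n => star (u n)) = u)//; apply/funext => n.
  by case: (pu n).
apply/cstar_posP; split=> // s s0.
have s2 : 0 < s / 2 by rewrite divr_gt0.
move/norm_cvgP: ua => /(_ _ s2)[N /(_ N (leqnn N)) uN].
have /cstar_posP[_ /(_ _ s2)[_ [c uc]]] := pu N.
split; first by rewrite starD sa star_rscalar.
(* The extra [s / 2] in the constant absorbs the error [cnorm (u N - a) < s / 2]. *)
exists (c + s / 2).
have -> : rscalar (c + s / 2) - (a + rscalar s) =
    rscalar c - (u N + rscalar (s / 2)) + (u N - a).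
  rewrite [in rscalar s](splitr s) !rscalarD; set h := rscalar (s / 2).
  rewrite opprD addrACA opprD [h + _]addrA subrr add0r.
  by rewrite (opprD (u N)) [rscalar c + (_ - h)]addrA
    [RHS]addrACA subrK addrA addrAC.
have := cnormD (rscalar c - (u N + rscalar (s / 2))) (u N - a); lra.
Qed.

Lemma cstar_pos_strictly_posD p a : cstar_pos p -> strictly_pos a ->
  strictly_pos (p + a).
Proof.
move=> /cstar_posP[_ pp] [sa [c ac]].
(* Half of the slack in [ac] is moved from [a] to [p]. *)
pose r := (c - cnorm (rscalar c - a)) / 2.
have r0 : 0 < r by rewrite divr_gt0// subr_gt0.
have -> : p + a = (a - rscalar r) + (p + rscalar r).
  by rewrite addrACA addNr addr0 addrC.
apply: strictly_posD; last exact: pp.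
split; first by rewrite starB sa star_rscalar.
exists (c - r); rewrite rscalarB opprB addrA subrK /r; lra.
Qed.

Lemma rscalar_sqrt s : 0 < s ->
  rscalar (Num.sqrt s) * rscalar (Num.sqrt s) = rscalar s :> A.
Proof. by move=> s0; rewrite -rscalarM -expr2 sqr_sqrtr// ltW. Qed.

(* [b p b + s = b (p + s d^2) b] with [d] the inverse of [b]. *)
Lemma cstar_pos_conj b p : star b = b -> invertible b -> cstar_pos p ->
  cstar_pos (b * p * b).
Proof.
move=> sb [d [bd db]] pp; apply: cstar_pos_invertible.
  by rewrite !starM sb pp.1 mulrA.
move=> s s0; pose e := rscalar (Num.sqrt s) * d.
have be : b * e = rscalar (Num.sqrt s) by rewrite /e rscalarC mulrA bd mul1r.
have eb : e * b = rscalar (Num.sqrt s) by rewrite -mulrA db mulr1.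
have -> : b * p * b + rscalar s = b * (p + e * e) * b.
  by rewrite mulrDr mulrDl (mulrA b e) be -(mulrA _ e) eb rscalar_sqrt.
have ib : invertible b by exists d.
apply: invertibleM => //; apply: invertibleM => //.
apply: strictly_pos_invertible; apply: cstar_pos_strictly_posD => //.
apply: strictly_pos_sqr_invertible.
  by rewrite star_rscalarM (star_inv sb bd db).
have ie : invertible e.
  apply: invertibleM; last by exists b.
  by apply: invertible_rscalar; rewrite gt_eqF// sqrtr_gt0.
exact: invertibleM.
Qed.

(* [a = (Y + t)^(-1/2)] gives [a Y a <= 1], hence [a X a <= 1] and
   [X <= Y + t]. *)
Lemma cstar_le_of_norm (X Y : A) : star X = X -> cstar_pos Y ->
  (forall a, star a = a -> cnorm (a * X * a) <= cnorm (a * Y * a)) -> X <=* Y.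
Proof.
move=> sX pY XY; apply/cstar_posP; split; first by rewrite starB sX pY.1.
move=> s s0; have t0 : 0 < s / 2 by rewrite divr_gt0.
have /cstar_posP[_ /(_ _ t0) spY] := pY.
have [b [sb bb _]] := strictly_pos_sqrt spY.
have ib : invertible b.
  apply: (@comm_invertibleM _ _ _ b) => //.
  by rewrite bb; exact: strictly_pos_invertible.
have [d [bd db]] := ib.
have sd : star d = d := star_inv sb bd db.
have id : invertible d by exists b.
have dYd : cnorm (d * Y * d) <= 1.
  apply: le_trans (cnorm1_le (A := A)); apply: cnorm_mono.
    exact: cstar_pos_conj.
  (* [d * Y * d] lies below [d * (Y + s / 2) * d = 1], the difference being a square. *)
  have : d * (Y + rscalar (s / 2)) * d = 1 by rewrite -bb !mulrA db mul1r bd.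
  rewrite mulrDr mulrDl => <-; rewrite /cstar_le addrC addKr.
  have -> : d * rscalar (s / 2) * d =
      rscalar (Num.sqrt (s / 2)) * d * (rscalar (Num.sqrt (s / 2)) * d).
    by rewrite rscalarMACA -expr2 sqr_sqrtr ?(ltW t0)// -rscalarC mulrA.
  by apply: cstar_pos_sqr; rewrite star_rscalarM sd.
(* Conjugating [1 - d * X * d] by [b] gives [Y + s / 2 - X]; the other half of [s] comes from
   [cstar_posP]. *)
have := cstar_pos_sub_norm _ (le_trans (XY _ sd) dYd).
rewrite rscalar1 !starM sd sX -mulrA => /(_ erefl)/(cstar_pos_conj sb ib).
rewrite mulrBr mulr1 mulrBl bb !mulrA bd mul1r -mulrA db mulr1.
move=> /cstar_posP[_ /(_ _ t0)].
by rewrite (addrAC Y) -(addrA (Y - X)) -rscalarD -splitr.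
Qed.

End CStarPositivity.

(** * Hilbert modules and square-summable families *)

Section HilbertModuleTheory.
Context {R : realType} {A : cstarAlgType R} {H : hilbertModType A}.
Implicit Types (a b : A) (x y z u v : H) (r s t : R) (f g : nat -> H).

Lemma innerDl x y z : inner (x + y) z = inner x z + inner y z.
Proof. by rewrite -[x]scale1r inner_linear mul1r scale1r. Qed.

Lemma inner0l z : inner (0 : H) z = 0.
Proof. by apply: (addrI (inner 0 z)); rewrite -innerDl !addr0. Qed.

Lemma innerZl a x z : inner (a *: x) z = a * inner x z.
Proof. by rewrite -[a *: x]addr0 inner_linear inner0l addr0. Qed.

Lemma innerNl x z : inner (- x) z = - inner x z.
Proof. by rewrite -scaleN1r innerZl mulN1r. Qed.

Lemma innerBl x y z : inner (x - y) z = inner x z - inner y z.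
Proof. by rewrite innerDl innerNl. Qed.

Lemma innerDr x y z : inner x (y + z) = inner x y + inner x z.
Proof. by rewrite inner_star innerDl starD -!inner_star. Qed.

Lemma innerZr a x z : inner x (a *: z) = inner x z * star a.
Proof. by rewrite inner_star innerZl starM -inner_star. Qed.

Lemma innerNr x z : inner x (- z) = - inner x z.
Proof. by rewrite inner_star innerNl starN -inner_star. Qed.

Lemma innerBr x y z : inner x (y - z) = inner x y - inner x z.
Proof. by rewrite innerDr innerNr. Qed.

(** [F (a *: x) - a *: F x] is orthogonal to every vector, hence to itself; linearity thus follows
    from having an adjoint. *)
Lemma adjoint_scale (F G : H -> H) :
    (forall x y, inner (F x) y = inner x (G y)) ->
  forall a x, F (a *: x) = a *: F x.
Proof.
move=> FG a x; apply/eqP; rewrite -subr_eq0; apply/eqP; apply: inner_eq0.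
by rewrite innerBl FG !innerZl FG subrr.
Qed.

Lemma op_scale (T : adjointable H) a x : T (a *: x) = a *: T x.
Proof. exact: adjoint_scale (op_adj T) a x. Qed.

Lemma adj_scale (T : adjointable H) a x : adj T (a *: x) = a *: adj T x.
Proof.
apply: (adjoint_scale (G := T)) => y z.
by rewrite inner_star -op_adj -inner_star.
Qed.

Lemma inner_scale a x : inner (a *: x) (a *: x) = a * inner x x * star a.
Proof. by rewrite innerZl innerZr mulrA. Qed.

Lemma cstar_pos_inner_scale r x : 0 < r -> cstar_pos (r%:C%C *: inner x x).
Proof.
move=> r0; have := inner_ge0 (rscalar (Num.sqrt r) *: x).
rewrite inner_scale star_rscalar rscalarC -mulrA rscalar_sqrt// -rscalarC.
by rewrite mulr_algl.
Qed.

Lemma conj_inner_scale r a x : star a = a ->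
  a * (r%:C%C *: inner x x) * a = r%:C%C *: inner (a *: x) (a *: x).
Proof. by move=> sa; rewrite inner_scale sa -scalerAr -scalerAl. Qed.

(** The difference of the two sides is the inner square of [k *: u - k^-1 *: v] with [k = sqrt t].
    The free [t] is optimised in [young_inf], giving a triangle inequality without
    Cauchy-Schwarz. *)
Lemma cstar_pos_young u v t : 0 < t ->
  inner (u + v) (u + v) <=*
    rscalar (1 + t) * inner u u + rscalar (1 + t^-1) * inner v v.
Proof.
move=> t0; set k := Num.sqrt t.
have k0 : k != 0 by rewrite gt_eqF// sqrtr_gt0.
have kk : k * k = t by rewrite -expr2 sqr_sqrtr// ltW.
rewrite /cstar_le.
rewrite (_ : _ - _ = inner (rscalar k *: u - rscalar k^-1 *: v)
                           (rscalar k *: u - rscalar k^-1 *: v)).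
  exact: inner_ge0.
have E r s x y : inner (rscalar r *: x) (rscalar s *: y) =
    rscalar (r * s) * inner x y.
  by rewrite innerZl innerZr star_rscalar -rscalarC mulrA -rscalarM.
rewrite innerBl !innerBr !E mulVf// divff// -invfM kk rscalar1 !mul1r.
rewrite innerDl !innerDr !rscalarD rscalar1 !mulrDl !mul1r.
set a := inner u u; set b := inner v v; set c := inner u v; set d := inner v u.
set p := rscalar t * a; set q := _ * b.
have sub (x y z : A) : x + y - (x + z) = y - z.
  by rewrite opprD addrACA subrr add0r.
by rewrite (addrC d b) opprD addrACA !sub opprB.
Qed.

Lemma cstar_pos0 : cstar_pos (0 : A).
Proof. by rewrite -(mulr0 0); apply: cstar_pos_sqr; rewrite star0. Qed.

Lemma cstar_pos_sum (I : Type) (r : seq I) (P : pred I) (F : I -> A) :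
  (forall i, P i -> cstar_pos (F i)) -> cstar_pos (\sum_(i <- r | P i) F i).
Proof.
by move=> PF; elim/big_ind: _ => //; [exact: cstar_pos0|exact: cstar_posD].
Qed.

Lemma cstar_le_sum_young (I : Type) (r : seq I) (P : pred I) (F G : I -> H) t :
    0 < t ->
  \sum_(i <- r | P i) inner (F i + G i) (F i + G i) <=*
    rscalar (1 + t) * (\sum_(i <- r | P i) inner (F i) (F i)) +
    rscalar (1 + t^-1) * (\sum_(i <- r | P i) inner (G i) (G i)).
Proof.
move=> t0; rewrite !mulr_sumr -big_split/= /cstar_le -sumrB.
by apply: cstar_pos_sum => i _; exact: cstar_pos_young.
Qed.

Lemma cnorm_sum_young (I : Type) (r : seq I) (P : pred I) (F G : I -> H) t :
    0 < t ->
  cnorm (\sum_(i <- r | P i) inner (F i + G i) (F i + G i)) <=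
    (1 + t) * cnorm (\sum_(i <- r | P i) inner (F i) (F i)) +
    (1 + t^-1) * cnorm (\sum_(i <- r | P i) inner (G i) (G i)).
Proof.
move=> t0; have ti : 0 < t^-1 by rewrite invr_gt0.
apply: (le_trans (cnorm_mono _ (cstar_le_sum_young _ _ _ _ t0))).
  by apply: cstar_pos_sum => i _; exact: inner_ge0.
apply: (le_trans (cnormD _ _)).
by rewrite !cnorm_rscalarM !gtr0_norm ?addr_gt0.
Qed.

(** * Square sums of families *)

Lemma sq_sumP J f : sq_summable J f ->
  norm_cvg cnorm (sq_partial_sum J f) (sq_sum J f).
Proof. by move=> /xgetPex; exact. Qed.

Lemma cstar_pos_sq_partial_sum J f n : cstar_pos (sq_partial_sum J f n).
Proof. by apply: cstar_pos_sum => i _; exact: inner_ge0. Qed.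

Lemma cstar_pos_sq_sum J f : sq_summable J f -> cstar_pos (sq_sum J f).
Proof.
move=> /sq_sumP; apply: cstar_pos_cvg => n; exact: cstar_pos_sq_partial_sum.
Qed.

Lemma sq_partial_sumB J f m n : (m <= n)%N ->
  sq_partial_sum J f n - sq_partial_sum J f m =
  \sum_(m <= i < n | i \in J) inner (f i) (f i).
Proof.
by move=> mn; rewrite /sq_partial_sum (big_cat_nat (leq0n m) mn)//= addrAC subrr
  add0r.
Qed.

Lemma sq_summable_tail J f e : sq_summable J f -> 0 < e ->
  exists N, forall m n, (N <= m)%N -> (m <= n)%N ->
    cnorm (\sum_(m <= i < n | i \in J) inner (f i) (f i)) < e.
Proof.
move=> [s /norm_cvgP fs] e0; have [N fN] := fs _ (divr_gt0 e0 (ltr0n _ 2)).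
exists N => m n Nm mn; rewrite -sq_partial_sumB//.
apply: le_lt_trans (cnorm_dist _ s _) _; rewrite (cnormBC s).
have := fN _ Nm; have := fN _ (leq_trans Nm mn); lra.
Qed.

Lemma sq_summableD J f g : sq_summable J f -> sq_summable J g ->
  sq_summable J (fun i => f i + g i).
Proof.
move=> sf sg; apply: cnorm_complete => e e0.
(* At [t = 1] both weights in the Young inequality are 2, hence tails below [e / 4]. *)
have e4 : 0 < e / 4 by rewrite divr_gt0.
have [N fN] := sq_summable_tail sf e4; have [M gM] := sq_summable_tail sg e4.
suff tl m n : (maxn N M <= m)%N -> (m <= n)%N -> cnorm
    (sq_partial_sum J (fun i => f i + g i) n -
     sq_partial_sum J (fun i => f i + g i) m) < e.
  exists (maxn N M) => m n Nm Nn; case: (leqP m n) => [mn|/ltnW nm].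
    by rewrite cnormBC; exact: tl.
  exact: tl.
rewrite geq_max => /andP[Nm Mm] mn; rewrite sq_partial_sumB//.
apply: le_lt_trans (cnorm_sum_young _ _ _ _ ltr01) _; rewrite invr1.
have := fN _ _ Nm mn; have := gM _ _ Mm mn; lra.
Qed.

Lemma sq_sum_young J f g t : sq_summable J f -> sq_summable J g -> 0 < t ->
  cnorm (sq_sum J (fun i => f i + g i)) <=
    (1 + t) * cnorm (sq_sum J f) + (1 + t^-1) * cnorm (sq_sum J g).
Proof.
move=> sf sg t0; have ti : 0 < t^-1 by rewrite invr_gt0.
have sfg := sq_summableD sf sg.
have le : sq_sum J (fun i => f i + g i) <=*
    rscalar (1 + t) * sq_sum J f + rscalar (1 + t^-1) * sq_sum J g.
  pose u n := rscalar (1 + t) * sq_partial_sum J f n +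
    rscalar (1 + t^-1) * sq_partial_sum J g n +
    -1 * sq_partial_sum J (fun i => f i + g i) n.
  apply: (@cstar_pos_cvg _ _ u).
    by move=> n; rewrite /u mulN1r; exact: cstar_le_sum_young.
  rewrite -mulN1r; apply: norm_cvgD; first apply: norm_cvgD.
  - exact/norm_cvgMl/sq_sumP.
  - exact/norm_cvgMl/sq_sumP.
  - exact/norm_cvgMl/sq_sumP.
apply: (le_trans (cnorm_mono (cstar_pos_sq_sum sfg) le)).
apply: (le_trans (cnormD _ _)).
by rewrite !cnorm_rscalarM !gtr0_norm ?addr_gt0.
Qed.

(** The optimal [t] is [q / p]; [d] is added to both so that neither vanishes, and costs at most
    [d * (p + q) <= e]. *)
Lemma young_inf (p q c : R) : 0 <= p -> 0 <= q ->
    (forall t, 0 < t -> c <= (1 + t) * p ^+ 2 + (1 + t^-1) * q ^+ 2) ->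
  c <= (p + q) ^+ 2.
Proof.
move=> p0 q0 cle; apply/ler_addgt0Pr => e e0.
pose d := e / (p + q + 1).
have pq : 0 < p + q + 1 by lra.
have d0 : 0 < d by rewrite divr_gt0.
have de : d * (p + q) <= e.
  have : d * (p + q + 1) = e by rewrite /d divfK// gt_eqF.
  by nra.
have pd : 0 < p + d by lra.
have qd : 0 < q + d by lra.
have := cle _ (divr_gt0 qd pd); rewrite invf_div => h; apply: (le_trans h).
have h1 : (q + d) / (p + d) * p ^+ 2 <= (q + d) * p.
  rewrite mulrAC ler_pdivrMr// -mulrA ler_wpM2l//; nra.
have h2 : (p + d) / (q + d) * q ^+ 2 <= (p + d) * q.
  rewrite mulrAC ler_pdivrMr// -mulrA ler_wpM2l//; nra.
rewrite !mulrDl !mul1r; nra.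
Qed.

Lemma sq_sum_triangle J f g : sq_summable J f -> sq_summable J g ->
  Num.sqrt (cnorm (sq_sum J (fun i => f i + g i))) <=
    Num.sqrt (cnorm (sq_sum J f)) + Num.sqrt (cnorm (sq_sum J g)).
Proof.
move=> sf sg.
rewrite -[leRHS]ger0_norm ?addr_ge0// -sqrtr_sqr ler_wsqrtr//.
apply: young_inf => // t t0.
by rewrite !sqr_sqrtr ?cnorm_ge0//; exact: sq_sum_young.
Qed.

Lemma sq_partial_sumN J f :
  sq_partial_sum J (fun i => - f i) = sq_partial_sum J f.
Proof.
by apply/funext => n; apply: eq_bigr => i _; rewrite innerNl innerNr opprK.
Qed.

Lemma sq_sumN J f : sq_sum J (fun i => - f i) = sq_sum J f.
Proof. by rewrite /sq_sum sq_partial_sumN. Qed.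

Lemma sq_summableN J f : sq_summable J f -> sq_summable J (fun i => - f i).
Proof. by rewrite /sq_summable sq_partial_sumN. Qed.

Lemma sq_sum_scale J f a : sq_summable J f ->
  sq_sum J (fun i => a *: f i) = a * sq_sum J f * star a.
Proof.
move=> /sq_sumP/(norm_cvg_mul a (star a)) fa.
have E : sq_partial_sum J (fun i => a *: f i) =
    fun n => a * sq_partial_sum J f n * star a.
  apply/funext => n; rewrite /sq_partial_sum mulr_sumr mulr_suml.
  by apply: eq_bigr => i _; rewrite inner_scale.
rewrite -E in fa.
have sfa : sq_summable J (fun i => a *: f i).
  by exists (a * sq_sum J f * star a).
exact: norm_limit_unique (sq_sumP sfa) fa.
Qed.

End HilbertModuleTheory.

(** * Perturbation of K-operator frames *)

Theorem theorem5p2 (R : realType) (cA : cstarAlgType R) (H : hilbertModType cA)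
    (K : adjointable H) (J : set nat) (T S : nat -> adjointable H)
    (A B alpha beta : R) :
  K_operator_frame J K T A B ->
  0 <= alpha -> 0 <= beta ->
  0 <= alpha + beta / A < 1 ->
  (forall x : H,
     sq_summable J (fun i => T i x - S i x) /\
     cnorm (sq_sum J (fun i => T i x - S i x)) <=
       alpha * cnorm (sq_sum J (fun i => T i x))
       + beta * cnorm (inner (adj K x) (adj K x))) ->
  K_operator_frame J K S
    (A * (1 - Num.sqrt (alpha + beta / A)) ^+ 2)
    (B * (1 + Num.sqrt (alpha + beta / A)) ^+ 2).
Proof.
move=> [A0 B0 frameT] alpha0 beta0 /andP[l0 l1] TS.
set q := Num.sqrt _.
have q0 : 0 <= q by exact: sqrtr_ge0.
have q1 : q < 1 by rewrite -sqrtr1 ltr_sqrt.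
(* Summability for [S] comes from [S = T - (T - S)]; the hypothesis provides it for [T - S]. *)
have sqS x : sq_summable J (fun i => S i x).
  have -> : (fun i => S i x) = (fun i => T i x + - (T i x - S i x)).
    by apply/funext => i; rewrite subKr.
  by apply: sq_summableD; [case: (frameT x)|apply/sq_summableN; case: (TS x)].
pose nT x := Num.sqrt (cnorm (sq_sum J (fun i => T i x))).
pose nS x := Num.sqrt (cnorm (sq_sum J (fun i => S i x))).
pose nD x := Num.sqrt (cnorm (sq_sum J (fun i => T i x - S i x))).
have lowT x : A * cnorm (inner (adj K x) (adj K x)) <=
    cnorm (sq_sum J (fun i => T i x)).
  have [_ /(cnorm_mono (cstar_pos_inner_scale _ A0)) + _] := frameT x.
  by rewrite cnorm_realZ gtr0_norm.
have upT x : cnorm (sq_sum J (fun i => T i x)) <= B * cnorm (inner x x).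
  have [sT _ /(cnorm_mono (cstar_pos_sq_sum sT))] := frameT x.
  by rewrite cnorm_realZ gtr0_norm.
(* The lower frame bound [lowT] replaces the [beta] term by [beta / A] times the norm of the square
   sum of [T], for a total factor [q ^+ 2]. *)
have nDle x : nD x <= q * nT x.
  rewrite /nD /q /nT -sqrtrM// ler_wsqrtr//.
  apply: (le_trans (TS x).2); rewrite mulrDl lerD2l mulrAC ler_pdivlMr//.
  by rewrite -mulrA ler_wpM2l// mulrC lowT.
have nSle x : nS x <= (1 + q) * nT x.
  rewrite mulrDl mul1r; apply: le_trans (lerD (lexx _) (nDle x)).
  have [[sT _ _] [sD _]] := (frameT x, TS x).
  have := sq_sum_triangle sT (sq_summableN sD); rewrite sq_sumN.
  by under eq_fun do rewrite subKr.
(* Reverse triangle inequality, from [T = S + (T - S)]. *)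
have nSge x : (1 - q) * nT x <= nS x.
  rewrite mulrBl mul1r lerBlDr; apply: le_trans (lerD (lexx _) (nDle x)).
  have := sq_sum_triangle (sqS x) (TS x).1.
  by under eq_fun do rewrite subrKC.
have sqle (p : R) (X Y : cA) : 0 <= p ->
    p * Num.sqrt (cnorm X) <= Num.sqrt (cnorm Y) -> p ^+ 2 * cnorm X <= cnorm Y.
  move=> p0 h; rewrite -(sqr_sqrtr (cnorm_ge0 X)) -(sqr_sqrtr (cnorm_ge0 Y)).
  by rewrite -exprMn lerXn2r// nnegrE ?mulr_ge0 ?sqrtr_ge0.
(* Conjugating the sum by a self-adjoint [a] amounts to evaluating at [a *: x], so norm bounds at
   every vector supply the hypothesis of [cstar_le_of_norm]. *)
have conjS x a : star a = a -> a * sq_sum J (fun i => S i x) * a =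
    sq_sum J (fun i => S i (a *: x)).
  move=> sa; rewrite -[in X in _ * X]sa -sq_sum_scale//.
  by congr sq_sum; apply/funext => i; rewrite op_scale.
have sS x := cstar_pos_sq_sum (sqS x).
have A'0 : 0 < A * (1 - q) ^+ 2 by rewrite mulr_gt0// exprn_gt0// subr_gt0.
have B'0 : 0 < B * (1 + q) ^+ 2 by rewrite mulr_gt0// exprn_gt0// ltr_wpDr.
split=> // x; split=> //; apply: cstar_le_of_norm.
- by have [] := cstar_pos_inner_scale (adj K x) A'0.
- exact: sS.
(* At [a *: x]: the lower bound for [T] times [(1 - q) ^+ 2], then [nSge] squared. *)
- move=> a sa; rewrite conj_inner_scale// conjS// cnorm_realZ gtr0_norm//.
  rewrite -adj_scale mulrAC; apply: le_trans (sqle _ _ _ _ (nSge (a *: x))).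
    by rewrite mulrC ler_wpM2l ?sqr_ge0.
  by rewrite subr_ge0 ltW.
- by have [] := sS x.
- exact: cstar_pos_inner_scale.
(* At [a *: x]: [nSle] squared, then the upper bound for [T]. *)
- move=> a sa; rewrite conj_inner_scale// conjS// cnorm_realZ gtr0_norm//.
  rewrite -(sqr_sqrtr (cnorm_ge0 (sq_sum _ _))) mulrAC.
  apply: (@le_trans _ _ ((1 + q) ^+ 2 * nT (a *: x) ^+ 2)).
    rewrite -exprMn lerXn2r ?nnegrE ?sqrtr_ge0 ?mulr_ge0 ?addr_ge0//.
      exact: sqrtr_ge0.
    exact: nSle.
  by rewrite mulrC ler_wpM2r ?sqr_ge0// sqr_sqrtr ?cnorm_ge0// upT.
Qed.
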